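(* Let $\mathbb{K}$ be a field, let $\mathcal{C}$ be an $[n,k,d]$-linear code over $\mathbb{K}$ with $\Sigma_{\mathcal{C}}=(\ell_1,\ldots,\ell_n)\subset R=\mathbb{K}[x_1,\ldots,x_k]$. Let $P(\mathcal{C})$ be the $\mathbb{K}$-vector subspace of $R$ spanned by the products $\ell_I=\prod_{i\in I}\ell_i$ for all $I\subseteq\{1,\ldots,n\}$ (with $\ell_\emptyset=1$). Then there is an isomorphism of $\mathbb{K}$-vector spaces $$P(\mathcal{C})\simeq \mathrm{Fitt}(\mathcal{C})\otimes_R\mathbb{K}.$$
   Context: An $[n,k,d]$-linear code $\mathcal{C}$ over a field $\mathbb{K}$ is the image of an injective linear map $\mathbb{K}^k\to\mathbb{K}^n$, $\mathbf{x}\mapsto \mathbf{x}G$, where $G=(a_{ij})$ is a $k\times n$ matrix over $\mathbb{K}$ of rank $k\ge 1$ (a generating matrix); $d$ is the smallest number of nonzero entries in a nonzero element of $\mathcal{C}$. $\Sigma_{\mathcal{C}}=(\ell_1,\ldots,\ell_n)$ is the collection of linear forms dual to the columns of $G$, $\ell_j=\sum_{i=1}^k a_{ij}x_i$; repetitions are allowed. The Fitting module of the code. For an $R$-module $M$ with free presentation $R^m\xrightarrow{\phi}R^n\to M\to 0$, let $I_j(\phi)$ be the ideal generated by the $j\times j$ minors of $\phi$ ($I_j(\phi)=R$ for $j\le 0$, $I_j(\phi)=0$ for $j>\min\{m,n\}$), $\mathrm{Fitt}_j(M)=I_{n-j}(\phi)$, and $\mathrm{Fitt}(M)=\bigoplus_{j=0}^n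 \mathrm{Fitt}_{n-j}(M)/\mathrm{Fitt}_{n-j-1}(M)$. Then $\mathrm{Fitt}(\mathcal{C}):=\mathrm{Fitt}(M)$ for $M=\mathrm{coker}(\mathrm{diag}(\ell_1,\ldots,\ell_n))=\bigoplus_{i=1}^n R/\langle\ell_i\rangle$. Explicitly, $\mathrm{Fitt}(\mathcal{C})=\bigoplus_{j=0}^{n} I(\mathcal{C},j)/I(\mathcal{C},j+1)$, where $I(\mathcal{C},0)=R$, $I(\mathcal{C},n+1)=0$, and for $1\le j\le n$, $I(\mathcal{C},j)=\langle \ell_{i_1}\cdots\ell_{i_j} : 1\le i_1<\cdots<i_j\le n\rangle\subset R$. $\mathbb{K}$ is regarded as the $R$-module $R/\mathfrak{m}$ with $\mathfrak{m}=\langle x_1,\ldots,x_k\rangle$. *)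

(* Defs.v *)
From HB Require Import structures.
From mathcomp Require Import all_boot all_order all_algebra.
From mathcomp Require Import boolp classical_sets.
From mathcomp.multinomials Require Import freeg mpoly.

Set Implicit Arguments.
Unset Strict Implicit.
Unset Printing Implicit Defensive.

Import GRing.Theory.
Local Open Scope ring_scope.
Local Open Scope quotient_scope.
Local Open Scope classical_set_scope.

Section Submodules.
Context (R : pzRingType) (V : lmodType R).

Definition lspan (X : set V) : {pred V} := fun v =>
  `[< exists2 s : seq (R * V), (forall p, p \in s -> X p.2)
        & v = \sum_(p <- s) p.1 *: p.2 >].

Fact lspan_closed X : submod_closed (lspan X).
Proof.
split=> [|a u v /asboolP[s sX ->] /asboolP[t tX ->]].
  by apply/asboolP; exists [::]; rewrite ?big_nil.
apply/asboolP; exists ([seq (a * p.1, p.2) | p <- s] ++ t) => [p|].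
  by rewrite mem_cat => /orP[/mapP[q /sX Xq ->]|/tX].
rewrite big_cat big_map scaler_sumr; congr (_ + _).
by apply: eq_bigr => p _; rewrite scalerA.
Qed.

HB.instance Definition _ X :=
  GRing.isSubmodClosed.Build R V (lspan X)
    (GRing.submod_closed_semi (lspan_closed X)).

Record submod (S : submodClosed V) :=
  Submod { submod_val : V; _ : submod_val \in S }.

HB.instance Definition _ S := [isSub for @submod_val S].
HB.instance Definition _ S := [Choice of submod S by <:].
HB.instance Definition _ S := [SubChoice_isSubLmodule of submod S by <:].

(* [submodClosed] does not inherit from [zmodClosed], which [Quotient.quot]
   requires. *)
Definition zmod_pred (S : submodClosed V) : {pred V} := S.

Fact zmod_pred_closed S : zmod_closed (zmod_pred S).
Proof. exact: GRing.submod_closedB (GRing.submodClosedP S). Qed.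

HB.instance Definition _ S :=
  GRing.isZmodClosed.Build V (zmod_pred S) (zmod_pred_closed S).

Definition quotmod (S : submodClosed V) := Quotient.quot (zmod_pred S).

Section QuotientModule.
Context (S : submodClosed V).
Local Notation Q := (quotmod S).

HB.instance Definition _ := GRing.Zmodule.on Q.
HB.instance Definition _ := EqQuotient.on Q.

Definition quot_scale (a : R) (x : Q) : Q := \pi_Q (a *: repr x).

Fact pi_scale a v : quot_scale a (\pi_Q v) = \pi_Q (a *: v).
Proof.
apply/eqP; rewrite /quot_scale -Quotient.idealrBE -scalerBr.
apply: (@rpredZ _ _ S); have: repr (\pi_Q v) - v \in zmod_pred S => //.
by rewrite Quotient.idealrBE reprK.
Qed.

Fact pi_add (u v : V) : \pi_Q (u + v) = \pi_Q u + \pi_Q v.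
Proof. exact: (raddfD \pi_(Quotient.quot (zmod_pred S))). Qed.

Fact quot_scaleA a b x : quot_scale a (quot_scale b x) = quot_scale (a * b) x.
Proof. by elim/quotW: x => v; rewrite (pi_scale b) !pi_scale scalerA. Qed.

Fact quot_scale1 : left_id 1 quot_scale.
Proof. by elim/quotW => v; rewrite pi_scale scale1r. Qed.

Fact quot_scaleDr : right_distributive quot_scale +%R.
Proof.
by move=> a; elim/quotW => u; elim/quotW => v; rewrite -pi_add !pi_scale scalerDr pi_add.
Qed.

Fact quot_scaleDl x : {morph quot_scale^~ x : a b / a + b}.
Proof. by move=> a b; elim/quotW: x => v; rewrite !pi_scale scalerDl pi_add. Qed.

HB.instance Definition _ := GRing.Zmodule_isLmodule.Build R Q
  quot_scaleA quot_scale1 quot_scaleDr quot_scaleDl.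

Fact pi_linear : linear (\pi_Q : V -> Q).
Proof. by move=> a u v; rewrite pi_add -pi_scale. Qed.

End QuotientModule.

End Submodules.

Section Subquotients.
Context (R : pzRingType) (V : lmodType R).

Definition comap (S T : submodClosed V) : {pred submod S} :=
  fun x => val x \in T.
Arguments comap : clear implicits.

Fact comap_closed S T : submod_closed (comap S T).
Proof.
split=> [|a u v uT vT]; first by rewrite unfold_in raddf0 rpred0.
by rewrite unfold_in linearP; apply: (GRing.submodClosedP T).2.
Qed.

HB.instance Definition _ S T :=
  GRing.isSubmodClosed.Build R (submod S) (comap S T)
    (GRing.submod_closed_semi (comap_closed S T)).

(* For T contained in S, this is S / T; in general it is S / (S `&` T). *)
Definition subquot (S T : submodClosed V) := quotmod (comap S T).

End Subquotients.

Section DirectSum.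
Context (R : pzRingType) (I : finType) (V : I -> lmodType R).

Definition dirsum := {dffun forall i, V i}.

HB.instance Definition _ := Choice.on dirsum.

Definition dirsum_zero : dirsum := [ffun i => 0].
Definition dirsum_opp (x : dirsum) : dirsum := [ffun i => - x i].
Definition dirsum_add (x y : dirsum) : dirsum := [ffun i => x i + y i].
Definition dirsum_scale a (x : dirsum) : dirsum := [ffun i => a *: x i].

Fact dirsum_addA : associative dirsum_add.
Proof. by move=> x y z; apply/ffunP => i; rewrite !ffunE addrA. Qed.

Fact dirsum_addC : commutative dirsum_add.
Proof. by move=> x y; apply/ffunP => i; rewrite !ffunE addrC. Qed.

Fact dirsum_add0 : left_id dirsum_zero dirsum_add.
Proof. by move=> x; apply/ffunP => i; rewrite !ffunE add0r. Qed.

Fact dirsum_addN : left_inverse dirsum_zero dirsum_opp dirsum_add.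
Proof. by move=> x; apply/ffunP => i; rewrite !ffunE addNr. Qed.

HB.instance Definition _ := GRing.isZmodule.Build dirsum
  dirsum_addA dirsum_addC dirsum_add0 dirsum_addN.

Fact dirsum_scaleA a b x :
  dirsum_scale a (dirsum_scale b x) = dirsum_scale (a * b) x.
Proof. by apply/ffunP => i; rewrite !ffunE scalerA. Qed.

Fact dirsum_scale1 : left_id 1 dirsum_scale.
Proof. by move=> x; apply/ffunP => i; rewrite !ffunE scale1r. Qed.

Fact dirsum_scaleDr : right_distributive dirsum_scale +%R.
Proof. by move=> a x y; apply/ffunP => i; rewrite !ffunE scalerDr. Qed.

Fact dirsum_scaleDl x : {morph dirsum_scale^~ x : a b / a + b}.
Proof. by move=> a b; apply/ffunP => i; rewrite !ffunE scalerDl. Qed.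

HB.instance Definition _ := GRing.Zmodule_isLmodule.Build R dirsum
  dirsum_scaleA dirsum_scale1 dirsum_scaleDr dirsum_scaleDl.

End DirectSum.

Section Tensor.
Context (R : comNzRingType) (M N : lmodType R).
Local Notation F := {freeg (M * N) / R}.

Variant tensor_rel : set F :=
| TensorDl x y z : tensor_rel (<< (x + y, z) >> - << (x, z) >> - << (y, z) >>)
| TensorDr x y z : tensor_rel (<< (x, y + z) >> - << (x, y) >> - << (x, z) >>)
| TensorZl a x y : tensor_rel (<< (a *: x, y) >> - a *: << (x, y) >>)
| TensorZr a x y : tensor_rel (<< (x, a *: y) >> - a *: << (x, y) >>).

Definition tensor := quotmod (lspan tensor_rel).

HB.instance Definition _ := GRing.Lmodule.on tensor.

End Tensor.

Definition restrict_scalars (R S : pzRingType) (f : {rmorphism R -> S})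
  (V : lmodType S) : Type := V.

Section RestrictionOfScalars.
Context (R S : pzRingType) (f : {rmorphism R -> S}) (V : lmodType S).
Local Notation restrict := (restrict_scalars f V).

HB.instance Definition _ := GRing.Zmodule.on restrict.

Definition restrict_scale (a : R) (x : restrict) : restrict :=
  f a *: (x : V).

Fact restrict_scaleA a b x :
  restrict_scale a (restrict_scale b x) = restrict_scale (a * b) x.
Proof. by rewrite /restrict_scale scalerA rmorphM. Qed.

Fact restrict_scale1 : left_id 1 restrict_scale.
Proof. by move=> x; rewrite /restrict_scale rmorph1 scale1r. Qed.

Fact restrict_scaleDr : right_distributive restrict_scale +%R.
Proof. by move=> a x y; rewrite /restrict_scale scalerDr. Qed.

Fact restrict_scaleDl x : {morph restrict_scale^~ x : a b / a + b}.
Proof. by move=> a b; rewrite /restrict_scale rmorphD scalerDl. Qed.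

HB.instance Definition _ := GRing.Zmodule_isLmodule.Build R restrict
  restrict_scaleA restrict_scale1 restrict_scaleDr restrict_scaleDl.

End RestrictionOfScalars.

Section FittingModule.
Context (R : comNzRingType) (m n : nat) (phi : 'M[R]_(m, n)).

Definition minor j : set R^o := [set x | exists (f : 'I_j -> 'I_m)
  (g : 'I_j -> 'I_n), [/\ {homo f : a b / (a < b)%N},
    {homo g : a b / (a < b)%N} & x = \det (mxsub f g phi)]].

Definition minors_ideal j : {pred R^o} := lspan (minor j).

HB.instance Definition _ j := GRing.SubmodClosed.on (minors_ideal j).

(* The matrix [phi] presents M = coker (u |-> u *m phi : R^m -> R^n), so that
   Fitt_(n - j)(M) = [minors_ideal j]; in particular the two edge cases
   Fitt_n(M) = R and Fitt_(-1)(M) = 0 are [minors_ideal 0] (the 0 x 0 minor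
   is 1) and [minors_ideal n.+1] (there are no such minors). *)
Definition fitting_module :=
  dirsum (fun j : 'I_n.+1 => subquot (minors_ideal j) (minors_ideal j.+1)).

HB.instance Definition _ := GRing.Lmodule.on fitting_module.

End FittingModule.

Section LinearCode.
Context (K : fieldType) (k n : nat).

Definition weight (c : 'rV[K]_n) : nat := #|[set j | c ord0 j != 0]%SET|.

Definition min_distance (C : set 'rV[K]_n) (d : nat) : Prop :=
  (exists2 c, C c /\ c != 0 & weight c = d) /\
  (forall c, C c -> c != 0 -> (d <= weight c)%N).

Definition linear_code (C : set 'rV[K]_n) (d : nat) (G : 'M[K]_(k, n)) : Prop :=
  [/\ (0 < k)%N, \rank G = k, C = range (fun x : 'rV[K]_k => x *m G)
    & min_distance C d].

Context (G : 'M[K]_(k, n)).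

Definition code_form (j : 'I_n) : {mpoly K[k]} := \sum_(i < k) G i j *: 'X_i.

Definition code_products : set {mpoly K[k]} :=
  range (fun I : {set 'I_n} => \prod_(i in I) code_form i).

Definition product_space := submod (lspan code_products).

HB.instance Definition _ := GRing.Lmodule.on product_space.

Definition code_fitting_module :=
  fitting_module (diag_mx (\row_j code_form j)).

HB.instance Definition _ := GRing.Lmodule.on code_fitting_module.

End LinearCode.

Definition residue_module (K : fieldType) (k : nat) :=
  quotmod (lspan (range (fun i : 'I_k => 'X_i : {mpoly K[k]}^o))).

HB.instance Definition _ K k := GRing.Lmodule.on (residue_module K k).

(* Main.v *)
Require Import Defs.
From HB Require Import structures.
From mathcomp Require Import all_boot all_order all_algebra.
From mathcomp Require Import perm.
From mathcomp Require Import boolp classical_sets.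
From mathcomp.multinomials Require Import freeg mpoly.

(** Write R for the polynomial ring, l_1, ..., l_n for the linear forms of the
    code, I_j for the ideal generated by the products of j of these forms and
    P for the K-span of all products of distinct forms.

    Everything is governed by degree. The ideal I_j is generated by forms of
    degree exactly j, so an element of I_j has no part of degree below j, its
    part of degree j is a K-combination of the generators, and multiplication
    by a in R acts on that part as multiplication by the constant term a(0)
    ([pihomog_lspan_lt], [pihomog_lspan_eq]). Tensoring with R/m, where m is
    generated by the variables, kills what has higher degree, so the tensor
    product of I_j / I_(j+1) with R/m is the space P_j spanned by the products
    of j forms, and P is the direct sum of the P_j.

    Concretely, the isomorphism [to_fitting] sends p to the tensor of the
    family of classes of the homogeneous parts p_j with the unit of R/m.

    - It is injective because it has a retraction. The pairing which sends
      (x, c) to c(0) times the sum over j of the degree j parts of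
      representatives of the x_j is well defined, since I_(j+1) has nothing in
      degree j, and R-bilinear, when R acts on polynomials through the
      constant term. The induced map on the tensor product sends the image
      of p to the sum of its homogeneous parts, which is p
      ([to_fitting_retract]).

    - It is surjective because its image is stable under R, which acts on
      tensors with R/m through the constant term, and contains the classes of
      the generators of each I_j ([part_class_minor]).

    The Fitting ideals are given by minors of the diagonal matrix of the forms.
    A j x j minor is an integer multiple of a product of j distinct forms
    ([diag_minorP]), and each such product is a principal minor
    ([prod_in_minors]). *)

Local Open Scope ring_scope.

Set Implicit Arguments.
Unset Strict Implicit.
Unset Printing Implicit Defensive.

Import GRing.Theory.
Local Open Scope quotient_scope.

(** * Spans and quotients of modules *)

Section Modules.
Context (R : pzRingType) (V : lmodType R).
Implicit Types (X : set V) (S : submodClosed V).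

Lemma mem_lspan X v : X v -> v \in lspan X.
Proof.
move=> Xv; apply/asboolP; exists [:: (1, v)] => [p|].
  by rewrite inE => /eqP ->.
by rewrite big_seq1 scale1r.
Qed.

Lemma lspan_ind X (P : V -> Prop) :
    P 0 -> (forall a u v, P u -> P v -> P (a *: u + v)) ->
    (forall v, X v -> P v) ->
  forall v, v \in lspan X -> P v.
Proof.
move=> P0 Plin PX v /asboolP[s sX ->]; elim: s sX => [|p s IHs] sX.
  by rewrite big_nil.
rewrite big_cons; apply: Plin; first by apply/PX/sX/mem_head.
by apply: IHs => q qs; apply: sX; rewrite inE qs orbT.
Qed.

(** The projection as a linear map, so that the generic lemmas on morphisms
    apply to it. *)
Definition pi_mod S (v : V) : quotmod S := \pi v.

HB.instance Definition _ S :=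
  GRing.isLinear.Build R V (quotmod S) _ (pi_mod S) (pi_linear S).

Lemma pi_mod_surj S (x : quotmod S) : exists v, x = pi_mod S v.
Proof. by elim/quotW: x => v; exists v. Qed.

Lemma pi_mod_eq0 S v : (pi_mod S v == 0) = (v \in S).
Proof.
rewrite -(raddf0 (pi_mod S)) -Quotient.idealrBE subr0.
by apply: esym; rewrite {1}unfold_in.
Qed.

(** The map induced on the quotient by [h]: evaluating [h] at an arbitrary
    representative is legitimate as soon as [h] vanishes on [S]. *)
Definition quot_lift S (W : lmodType R) (h : V -> W) (x : quotmod S) : W :=
  h (repr x).

Lemma quot_lift_pi S (W : lmodType R) (h : {linear V -> W}) :
  {in S, h =1 fun=> 0} -> forall v, quot_lift h (pi_mod S v) = h v.
Proof.
move=> hS v; apply/eqP; rewrite -subr_eq0 -raddfB; apply/eqP/hS.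
by rewrite -pi_mod_eq0 raddfB subr_eq0; apply/eqP/reprK.
Qed.

Lemma quot_lift_linear S (W : lmodType R) (h : {linear V -> W}) :
  {in S, h =1 fun=> 0} -> linear (quot_lift h : quotmod S -> W).
Proof.
move=> hS a x y; have [u ->] := pi_mod_surj x; have [v ->] := pi_mod_surj y.
by rewrite -linearP !quot_lift_pi // linearP.
Qed.

End Modules.

(** * Injections into a direct sum *)

Section DirectSum.
Context (R : pzRingType) (I : finType) (V : I -> lmodType R).

Definition dirsum_inj (i : I) (v : V i) : dirsum V :=
  [ffun j => dfwith (fun j => 0 : V j) v j].

Lemma dirsum_inj_linear i : linear (@dirsum_inj i).
Proof.
move=> a u v; apply/ffunP => j; rewrite !ffunE.
case: (eqVneq i j) => [<-|ij]; first by rewrite !dfwith_in.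
by rewrite !dfwith_out // scaler0 addr0.
Qed.

HB.instance Definition _ i :=
  GRing.isLinear.Build R (V i) (dirsum V) _ (@dirsum_inj i)
    (@dirsum_inj_linear i).

Lemma dirsum_sumE (J : Type) (r : seq J) (F : J -> dirsum V) i :
  (\sum_(j <- r) F j) i = \sum_(j <- r) F j i.
Proof.
elim: r => [|j r IHr]; first by rewrite !big_nil ffunE.
by rewrite !big_cons ffunE IHr.
Qed.

Lemma dirsum_sum_inj (x : dirsum V) : x = \sum_i dirsum_inj (x i).
Proof.
apply/ffunP => j; rewrite dirsum_sumE (bigD1 j) //= ffunE dfwith_in.
by rewrite big1 ?addr0 // => i ij; rewrite ffunE dfwith_out.
Qed.

End DirectSum.

(** * Linear extension to a free module *)

Section FreeModule.
Context (R : nzRingType) (T : choiceType) (W : lmodType R) (f : T -> W).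

HB.instance Definition _ :=
  GRing.isZmodMorphism.Build {freeg T / R} W (fglift f) (lift_is_additive f).

Lemma freegU_scale (a c : R) (z : T) :
  a *: << c *g z >> = << a * c *g z >> :> {freeg T / R}.
Proof. by apply/eqP/freeg_eqP => w; rewrite coeffZ !coeffU mulrA. Qed.

Lemma fglift_linear : linear (fglift f).
Proof.
move=> a u v; rewrite raddfD /=; congr (_ + _).
rewrite -[u]freeg_sumE; elim: (dom u) => [|z s IHs].
  by rewrite big_nil scaler0 raddf0 scaler0.
rewrite big_cons scalerDr !raddfD; congr (_ + _); last exact: IHs.
by rewrite freegU_scale /= !liftU scalerA.
Qed.

HB.instance Definition _ :=
  GRing.isLinear.Build R {freeg T / R} W _ (fglift f) fglift_linear.

End FreeModule.

(** * The universal property of the tensor product *)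

Section Tensor.
Context (R : comNzRingType) (M N : lmodType R).
Local Notation F := {freeg (M * N) / R}.
Local Notation rels := (lspan (@tensor_rel R M N)).

Definition tens (x : M) (y : N) : tensor M N := pi_mod rels <<(x, y)>>.

Lemma tens_rel_eq (u v : F) :
  tensor_rel (u - v) -> pi_mod rels u = pi_mod rels v.
Proof.
move=> uv; apply/eqP; rewrite -subr_eq0 -raddfB pi_mod_eq0.
exact: mem_lspan.
Qed.

Lemma tensZl a x y : tens (a *: x) y = a *: tens x y.
Proof. by rewrite /tens (tens_rel_eq (TensorZl a x y)) linearZ. Qed.

Lemma tensZr a x y : tens x (a *: y) = a *: tens x y.
Proof. by rewrite /tens (tens_rel_eq (TensorZr a x y)) linearZ. Qed.

Lemma tens_linearl y : linear (tens^~ y).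
Proof.
move=> a u v; rewrite -tensZl /tens -raddfD; apply: tens_rel_eq.
by rewrite opprD addrA; apply: TensorDl.
Qed.

(** Scalars of formal combinations can be moved into the linear structure, so
    pure tensors generate the tensor product as a module. *)
Lemma tens_ind (P : tensor M N -> Prop) :
    P 0 -> (forall a t u, P t -> P u -> P (a *: t + u)) ->
    (forall x y, P (tens x y)) ->
  forall t, P t.
Proof.
move=> P0 Plin Ptens t; have [u ->] := pi_mod_surj t.
rewrite -[u]freeg_sumE; elim: (dom u) => [|[x y] s IHs].
  by rewrite big_nil raddf0.
rewrite big_cons raddfD /= -[coeff _ u]mulr1 -freegU_scale.
by rewrite linearZ; apply: (Plin _ _ _ (Ptens x y)).
Qed.

(** A bilinear map extends linearly to the free module on pairs, where
    bilinearity says precisely that it kills the defining relations. *)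
Lemma tens_lift (W : lmodType R) (b : M -> N -> W) :
    (forall y, linear (b^~ y)) -> (forall x, linear (b x)) ->
  exists g : {linear tensor M N -> W}, forall x y, g (tens x y) = b x y.
Proof.
move=> bl br; pose H : {linear F -> W} := fglift (fun z : M * N => b z.1 z.2).
have HU x y : H << (x, y) >> = b x y by rewrite /H /= liftU scale1r.
have Hrel : {in rels, H =1 fun=> 0}.
  apply: lspan_ind => [|a u v Hu Hv|v]; first exact: raddf0.
    by rewrite linearP /= Hu Hv scaler0 addr0.
  have bD x y z : b (x + y) z = b x z + b y z.
    by have := bl z 1 x y; rewrite !scale1r.
  have bDr x y z : b x (y + z) = b x y + b x z.
    by have := br x 1 y z; rewrite !scale1r.
  have b0 y : b 0 y = 0.
    by apply: (addrI (b 0 y)); rewrite -bD !addr0.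
  have b0r x : b x 0 = 0.
    by apply: (addrI (b x 0)); rewrite -bDr !addr0.
  case=> [x y z|x y z|a x y|a x y]; rewrite !(linearB, linearZ) /= !HU.
  - by rewrite bD addrAC addrK subrr.
  - by rewrite bDr addrAC addrK subrr.
  - have := bl y a x 0; rewrite !addr0 => ->.
    by rewrite b0 addr0 scalerN subrr.
  - have := br x a y 0; rewrite !addr0 => ->.
    by rewrite b0r addr0 scalerN subrr.
have glin := quot_lift_linear Hrel.
pose q : quotmod rels -> W := quot_lift H.
pose qL := GRing.isLinear.Build _ _ _ _ q glin.
pose g : {linear quotmod rels -> W} := HB.pack q qL.
exists g => x y.
by rewrite /= /tens /q quot_lift_pi // HU.
Qed.

End Tensor.

(** * Lowest-degree parts of ideals generated in one degree *)

Section Homogeneous.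
Context (K : fieldType) (k : nat).
Implicit Types (a p : {mpoly K[k]}) (X : set {mpoly K[k]}^o).

Local Notation hpart := (@pihomog k K (@mdeg k)).

(** Only the constant term of [a] can contribute to the parts of [a * p] of
    degree at most [d]: every other monomial raises the degree. *)
Lemma pihomogM_ge d e a p : (e <= d)%N -> p \is d.-homog ->
  hpart e (a * p) = if e == d then a@_0%MM *: p else 0.
Proof.
move=> le_ed p_hom; elim/mpolyind: a => [|c m a _ _ IHa].
  by rewrite mul0r raddf0 mcoeff0 scale0r if_same.
rewrite mulrDl raddfD /= {}IHa mcoeffD mcoeffZ mcoeffX -scalerAl linearZ /=.
have mp_hom : 'X_[m] * p \is (mdeg m + d).-homog.
  by apply: dhomogM => //; rewrite dhomogX.
have [->|m_neq0] := eqVneq m 0%MM.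
  rewrite mpolyX0 mul1r mulr1 scalerDl; case: eqP => [->|/eqP ed].
    by rewrite pihomog_dE.
  by rewrite (pihomog_ne0 _ p_hom) 1?eq_sym // scaler0 addr0.
rewrite (pihomog_ne0 _ mp_hom) ?mulr0 ?scaler0 ?add0r //.
rewrite gtn_eqF // (leq_ltn_trans le_ed) //.
by rewrite -{1}[d]add0n ltn_add2r lt0n mdeg_eq0.
Qed.

Lemma pihomog_lspan_lt X d e : (forall p, X p -> p \is d.-homog) -> (e < d)%N ->
  {in lspan X, hpart e =1 fun=> 0}.
Proof.
move=> Xd lt_ed p pX.
suff H : forall a, hpart e (a * p) = 0 by rewrite -[p]mul1r H.
move: p pX.
refine (lspan_ind (V := {mpoly K[k]}^o)
  (P := fun p => forall a, hpart e (a * p) = 0) _ _ _)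
  => [a|b u v Hu Hv a|p /Xd p_hom a].
- by rewrite mulr0 raddf0.
- by rewrite mulrDr mulrA raddfD /= Hu Hv addr0.
- by rewrite (pihomogM_ge _ (ltnW lt_ed) p_hom) ltn_eqF.
Qed.

(** This is what makes an ideal generated in degree [d], modulo the maximal
    ideal, see only its degree [d] part. *)
Lemma pihomog_lspan_eq X d : (forall p, X p -> p \is d.-homog) ->
  forall p, p \in lspan X -> forall a, hpart d (a * p) = a@_0%MM *: hpart d p.
Proof.
move=> Xd.
refine (lspan_ind (V := {mpoly K[k]}^o)
  (P := fun p => forall a, hpart d (a * p) = a@_0%MM *: hpart d p) _ _ _)
  => [a|b u v Hu Hv a|p /Xd p_hom a].
- by rewrite mulr0 raddf0 scaler0.
- rewrite -[b *: u]/(b * u) mulrDr mulrA !raddfD /= !Hu Hv rmorphM /=.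
  by rewrite scalerA.
- by rewrite (pihomogM_ge _ (leqnn d) p_hom) eqxx (pihomog_dE p_hom).
Qed.

(** The residue module is [K]: each nonconstant monomial is a multiple of some
    variable. *)
Lemma sub_mcoeff0_lspanX p :
  p - (p@_0)%:MP \in lspan (range (fun i : 'I_k => 'X_i : {mpoly K[k]}^o)).
Proof.
set S := lspan _; have S0 : 0 \in S by apply: (rpred0 S).
elim/mpolyind: p => [|c m p _ _ IHp]; first by rewrite mcoeff0 mpolyC0 subr0.
rewrite mcoeffD mcoeffZ mcoeffX mpolyCD opprD addrACA.
apply: (rpredD (S := S)) => //.
have [->|m_neq0] := eqVneq m 0%MM.
  by rewrite mpolyX0 mulr1 -mul_mpolyC mulr1 subrr.
have [i mi_neq0] : exists i, m i != 0%N.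
  apply/existsP; apply: contraNT m_neq0 => /existsPn m0.
  by apply/eqP/mnmP => i; rewrite mnm0E; apply/eqP/negPn.
rewrite mulr0 mpolyC0 subr0 -(submK (_ : (U_(i) <= m)%MM)) ?lep1mP //.
rewrite mpolyXD scalerAl.
by apply: (rpredZ (s := S)); apply: mem_lspan; exists i.
Qed.

End Homogeneous.

(** * Minors of a diagonal matrix *)

Section Minors.
Context (R : comNzRingType) (n : nat) (v : 'I_n -> R).

Local Notation D := (diag_mx (\row_j v j)).

(** Only the permutations [s] with [f = g \o s] survive in the Leibniz
    expansion, and each contributes the same product up to sign. Keeping their
    signed count as an integer [c] avoids deciding whether [f] and [g] agree;
    that [c] is an integer, not an arbitrary element of the ring, is what
    keeps minors homogeneous and in the span of the products. *)
Lemma diag_minorP j x : minor D j x ->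
  exists2 f : 'I_j -> 'I_n, injective f &
    exists c : int, x = (\prod_i v (f i)) *~ c.
Proof.
case=> f [g [f_incr g_incr ->]]; exists f.
  move=> a b fab; apply/val_inj/eqP; case: ltngtP => // /f_incr;
  by rewrite fab ltnn.
exists (\sum_(s : 'S_j) (-1) ^+ s * \prod_i (f i == g (s i))%:R).
rewrite -mulrzl rmorph_sum mulr_suml; apply: eq_bigr => s _.
rewrite rmorphM rmorphXn rmorphN1 rmorph_prod -mulrA -big_split /=.
congr (_ * _); apply: eq_bigr => i _.
by rewrite !mxE rmorph_nat mulr_natl.
Qed.

(** The enumeration of a set of ordinals is a subsequence of [0, ..., n - 1], so
    it is an admissible choice of rows and columns for a minor. *)
Lemma enum_val_incr (I : {set 'I_n}) :
  {homo (@enum_val _ (mem I)) : a b / (a < b)%N}.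
Proof.
have sI : sorted ltn (map val (enum I)).
  rewrite sorted_map; apply: sorted_filter => [a b c|]; first exact: ltn_trans.
  rewrite -enumT; have := iota_ltn_sorted 0 n.
  by rewrite -val_enum_ord sorted_map.
move=> a b ab; have x0 : 'I_n := enum_val a.
rewrite !(enum_val_nth x0) -!(nth_map _ (x0 : nat) val) -?cardE //.
by apply: (sorted_ltn_nth ltn_trans) => //; rewrite inE size_map -cardE.
Qed.

Lemma prod_in_minors (I : {set 'I_n}) : minor D #|I| (\prod_(i in I) v i).
Proof.
exists enum_val, enum_val; split; try exact: enum_val_incr.
have -> : mxsub enum_val enum_val D = diag_mx (\row_(i < #|I|) v (enum_val i)).
  apply/matrixP => a b; rewrite !mxE; congr (_ *+ _).
  by rewrite (inj_eq enum_val_inj).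
by rewrite det_diag big_enum_val; apply: eq_bigr => i _; rewrite mxE.
Qed.

End Minors.

(** * The isomorphism *)

Section Code.
Context (K : fieldType) (k n : nat) (G : 'M[K]_(k, n)).

Local Notation A := {mpoly K[k]}.
Local Notation hpart := (@pihomog k K (@mdeg k)).
Local Notation l := (code_form G).
Local Notation D := (diag_mx (\row_j l j)).
Local Notation I := (minors_ideal D).
Local Notation P := (lspan (code_products G)).
Local Notation residue := (residue_module K k).

Lemma code_form_homog j : l j \is 1.-homog.
Proof. by apply: rpred_sum => i _; apply: rpredZ; rewrite dhomogX /= mdeg1. Qed.

Lemma prod_forms_homog (J : finType) (S : {pred J}) (f : J -> 'I_n) :
  \prod_(i in S) l (f i) \is #|S|.-homog.
Proof.
rewrite -big_enum cardE /=; elim: (enum S) => [|i s IHs].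
  by rewrite big_nil dhomog1.
by rewrite big_cons /= -add1n; apply: dhomogM => //; apply: code_form_homog.
Qed.

Lemma minor_homog j x : minor D j x -> x \is j.-homog.
Proof.
case/diag_minorP => f _ [c ->]; apply: rpredMz.
by have := prod_forms_homog xpredT f; rewrite card_ord.
Qed.

Lemma minor_in_products j x : minor D j x -> x \in P.
Proof.
case/diag_minorP => f f_inj [c ->]; apply: (@rpredMz _ P); apply: mem_lspan.
exists [set f i | i in 'I_j]%SET => //.
by rewrite big_imset //= => a b _ _; apply: f_inj.
Qed.

(** A homogeneous part of an element of [P] collects the products of that many
    forms. *)
Lemma pihomog_product_in_ideal j p : p \in P -> hpart j p \in I j.
Proof.
move: p; apply: lspan_ind => [|a u v Hu Hv|_ [S _ <-]].
- by rewrite raddf0; apply: (rpred0 (I j)).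
- rewrite linearP /=; apply: (rpredD (S := I j)) => //.
  by rewrite -mul_mpolyC; apply: (rpredZ (s := I j)).
- have S_hom := prod_forms_homog (mem S) id.
  have [<-|neq] := eqVneq #|S| j.
    by rewrite pihomog_dE //; apply/mem_lspan/prod_in_minors.
  by rewrite (pihomog_ne0 neq S_hom); apply: (rpred0 (I j)).
Qed.

(** Products of distinct forms have at most [n] factors, so the degrees
    [0, ..., n] exhaust an element of [P]. *)
Lemma product_sum_pihomog p : p \in P -> \sum_(j < n.+1) hpart j p = p.
Proof.
move: p; apply: lspan_ind => [|a u v Hu Hv|_ [S _ <-]].
- by rewrite big1 // => j _; rewrite raddf0.
- rewrite -{2}Hu -{2}Hv scaler_sumr -big_split /=.
  by apply: eq_bigr => j _; rewrite linearP.
- have S_hom := prod_forms_homog (mem S) id.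
  have lt_Sn : (#|S| < n.+1)%N.
    by rewrite ltnS (leq_trans (max_card _)) ?card_ord.
  rewrite (bigD1 (Ordinal lt_Sn)) //= (pihomog_dE S_hom).
  rewrite [X in _ + X]big1 ?addr0 // => j.
  by rewrite -val_eqE /= eq_sym => neq; rewrite (pihomog_ne0 neq S_hom).
Qed.

Definition part j (p : product_space G) : submod (I j) :=
  Submod (pihomog_product_in_ideal j (valP p)).

Lemma partP j a (p q : product_space G) :
  part j (a *: p + q) = a%:MP *: part j p + part j q.
Proof. by apply/val_inj; rewrite /= !linearP /= -mul_mpolyC. Qed.

Definition part_class (p : product_space G) : code_fitting_module G :=
  [ffun j : 'I_n.+1 => pi_mod (comap (I j.+1)) (part j p)].

Definition res (a : A) : residue :=
  pi_mod (lspan (range (fun i : 'I_k => 'X_i : A^o))) a.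

Lemma res_scale a : a *: res 1 = (a@_0%MM)%:MP *: res 1.
Proof.
rewrite -!linearZ /=; apply/eqP; rewrite -subr_eq0 -raddfB pi_mod_eq0.
by rewrite -scalerBl -[_ *: _]/(_ * _) mulr1 sub_mcoeff0_lspanX.
Qed.

Definition to_fitting (p : product_space G) :
  restrict_scalars (@mpolyC k K) (tensor (code_fitting_module G) residue) :=
  tens (part_class p) (res 1).

Lemma part_classP a p q :
  part_class (a *: p + q) = a%:MP *: part_class p + part_class q.
Proof. by apply/ffunP => j; rewrite !ffunE partP linearP. Qed.

Lemma to_fitting_linear : linear to_fitting.
Proof. by move=> a p q; rewrite /to_fitting part_classP tens_linearl. Qed.

HB.instance Definition _ := GRing.isLinear.Build K (product_space G)
  (restrict_scalars (@mpolyC k K) (tensor (code_fitting_module G) residue)) _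
  to_fitting to_fitting_linear.

Local Notation "W @0" := (restrict_scalars (@mcoeff k K 0%MM) W)
  (at level 2, format "W @0").

(** An element of [I_j] starts in degree [j]; this is its initial part. *)
Definition low_part j (u : submod (I j)) : A @0 := hpart j (val u).

Lemma low_part_linear j : linear (@low_part j).
Proof.
move=> a u v; rewrite /low_part linearP raddfD; congr (_ + _).
exact: (pihomog_lspan_eq (@minor_homog j) (valP u)).
Qed.

HB.instance Definition _ j :=
  GRing.isLinear.Build A (submod (I j)) (A @0) _ (@low_part j)
    (@low_part_linear j).

Lemma low_part_eq0 j : {in comap (I j.+1), @low_part j =1 fun=> 0}.
Proof. by move=> u; apply: (pihomog_lspan_lt (@minor_homog j.+1)). Qed.

Definition sum_low_part (x : code_fitting_module G) : A @0 :=
  \sum_(j < n.+1) quot_lift (@low_part j) (x j).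

Lemma sum_low_part_linear : linear sum_low_part.
Proof.
move=> a x y; rewrite /sum_low_part scaler_sumr -big_split.
by apply: eq_bigr => j _; rewrite !ffunE (quot_lift_linear (@low_part_eq0 j)).
Qed.

Definition eval0 (a : A^o) : (K^o) @0 := a@_0%MM.

Lemma eval0_linear : linear eval0.
Proof.
by move=> a u v; rewrite /eval0 raddfD; congr (_ + _); apply: rmorphM.
Qed.

HB.instance Definition _ :=
  GRing.isLinear.Build A A^o ((K^o) @0) _ eval0 eval0_linear.

Lemma eval0_eq0 :
  {in lspan (range (fun i : 'I_k => 'X_i : A^o)), eval0 =1 fun=> 0}.
Proof.
apply: lspan_ind => [|a u v Hu Hv|_ [i _ <-]]; first exact: raddf0.
  by rewrite linearP /= Hu Hv scaler0 addr0.
by rewrite /eval0 mcoeffX mnm1_eq0.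
Qed.

(** The retraction comes from a pairing with values in the polynomials, on which
    [R] acts through the constant term; that twist is needed for the pairing
    to be [R]-linear in each variable. *)
Lemma to_fitting_retract :
  exists g : {linear tensor (code_fitting_module G) residue -> A @0},
    forall p, g (to_fitting p) = val p.
Proof.
pose b x (c : residue) : A @0 :=
  (quot_lift eval0 c : K) *: (sum_low_part x : A).
have scale0E (a : A) (w : A @0) : a *: w = a@_0%MM *: (w : A) by [].
have bl c : linear (b^~ c).
  move=> a u v; rewrite /b sum_low_part_linear scalerDr; congr (_ + _).
  by rewrite !scale0E !scalerA mulrC.
have br x : linear (b x).
  move=> a u v; rewrite /b (quot_lift_linear eval0_eq0) scalerDl.
  by rewrite scale0E scalerA.
have [g gE] := tens_lift bl br.
exists g => p; rewrite gE /b (quot_lift_pi eval0_eq0).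
rewrite [GRing.Linear.sort _ _]mcoeff1 eqxx scale1r.
rewrite -[RHS](product_sum_pihomog (valP p)); apply: eq_bigr => j _.
by rewrite ffunE (quot_lift_pi (@low_part_eq0 j)); apply: pihomog_id.
Qed.

Lemma to_fitting_scale a p :
  a *: (to_fitting p : tensor _ _) = to_fitting (a@_0%MM *: p).
Proof. by rewrite linearZ /= /to_fitting -tensZr res_scale tensZr. Qed.

(** A minor is homogeneous and lies in [P], so it is its own preimage: its parts
    in the other degrees vanish. *)
Lemma part_class_minor (j : 'I_n.+1) (u : submod (I j)) : minor D j (val u) ->
  exists p, part_class p = dirsum_inj (pi_mod (comap (I j.+1)) u).
Proof.
move=> u_minor; exists (Submod (minor_in_products u_minor)).
have u_hom := minor_homog u_minor.
apply/ffunP => i; rewrite !ffunE; have [<-|ji] := eqVneq j i.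
  rewrite dfwith_in; congr (pi_mod _ _).
  by apply/val_inj; rewrite /= pihomog_dE.
rewrite dfwith_out //; apply/eqP; rewrite pi_mod_eq0.
have -> : part i (Submod (minor_in_products u_minor)) = 0.
  by apply/val_inj; rewrite /= (pihomog_ne0 _ u_hom).
exact: (rpred0 (comap (I i.+1))).
Qed.

(** The image is an [R]-submodule, so it is enough to reach generators. Pure
    tensors reduce in turn to those with second factor the unit class, then
    to a first factor concentrated in one summand, and finally to the class of
    a minor. *)
Lemma to_fitting_surj t : exists p, to_fitting p = t.
Proof.
pose im (t : tensor (code_fitting_module G) residue) :=
  exists p, to_fitting p = t.
have im0 : im 0 by exists 0; rewrite raddf0.
have imP a u v : im u -> im v -> im (a *: u + v).
  move=> [p <-] [q <-]; exists (a@_0%MM *: p + q).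
  by rewrite to_fitting_scale raddfD.
have tens0 : tens 0 (res 1) = 0 :> tensor (code_fitting_module G) residue.
  by rewrite -(scale0r 0) tensZl scale0r.
rewrite -[exists p, _]/(im t); elim/tens_ind: t => // x c.
have [a ->] : exists a, c = a *: res 1.
  have [a ->] := pi_mod_surj c; exists a.
  by rewrite -linearZ /= -[a *: 1]/(a * 1) mulr1.
rewrite tensZr -[_ *: _]addr0; apply: (imP) => //.
rewrite [x]dirsum_sum_inj.
elim: (index_enum _) => [|j s IHs]; first by rewrite big_nil tens0.
rewrite big_cons -[dirsum_inj _]scale1r tens_linearl.
apply: (imP); last exact: IHs.
have [u ->] := pi_mod_surj (x j).
suff [w /val_inj -> //] : exists2 w : submod (I j), val w = val u &
    im (tens (dirsum_inj (pi_mod (comap (I j.+1)) w)) (res 1)).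
(* Membership in [I j] becomes part of the claim, so that the induction can run
   on the bare polynomial. *)
case: u => u Iu /=; move: u Iu.
apply: lspan_ind => [|b _ _ [u <- Hu] [v <- Hv]|u u_minor].
- by exists 0 => //; rewrite !raddf0 tens0.
- exists (b *: u + v) => //.
  rewrite !linearP /= tens_linearl; exact: imP.
- have Iu : u \in I j by apply: mem_lspan.
  exists (Submod Iu) => //.
  have [p pE] := @part_class_minor j (Submod Iu) u_minor.
  by exists p; rewrite /to_fitting pE.
Qed.

End Code.

Theorem theorem2p2 (K : fieldType) (n k d : nat) (C : set 'rV[K]_n)
    (G : 'M[K]_(k, n)) :
  linear_code C d G ->
  exists f : {linear product_space G ->
    restrict_scalars (@mpolyC k K)
      (tensor (code_fitting_module G) (residue_module K k))},
    bijective f.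
Proof.
move=> _; exists (@to_fitting K k n G).
have [g gK] := to_fitting_retract G.
have f_inj : injective (@to_fitting K k n G).
  by move=> p q /(congr1 g); rewrite !gK => /val_inj.
have surj t : exists p : product_space G, to_fitting p == t.
  by have [p <-] := to_fitting_surj t; exists p.
exists (fun t => xchoose (surj t)) => [p|t].
  exact/f_inj/eqP/(xchooseP (surj (to_fitting p))).
exact/eqP/(xchooseP (surj t)).
Qed.
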